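(* Suppose $S\in\mathbb R^{d\times d}$ is nonnegative and irreducible, and the solution $m(z)$ of the Dyson equation is uniformly bounded on $\mathbb C_+(I)$, where $I=[\alpha,\beta]\subset\mathbb R$ is a closed interval. Then for every $1\le i\le d$, $$|m_i(z)|\sim\frac1{1+|z|},\qquad z\in\overline{\mathbb C_+}(I).$$ Moreover, the imaginary parts of the components are comparable: for every $1\le i<j\le d$, $$\operatorname{Im}m_i(z)\sim\operatorname{Im}m_j(z),\qquad z\in\overline{\mathbb C_+}(I).$$
   Context: $\mathbb C_+=\{z\in\mathbb C:\operatorname{Im}z>0\}$. Let $d\ge1$, $S=(s_{ij})\in\mathbb R^{d\times d}$ entrywise nonnegative, $\mathbf a=(a_i)\in\mathbb R^d$. $S$ is irreducible if for all $i,j$ there is $n\ge1$ with $(S^n)_{ij}>0$. For each $z\in\mathbb C_+$, $m(z)=(m_1(z),\dots,m_d(z))\in\mathbb C_+^d$ denotes the unique solution in $\mathbb C_+^d$ of the Dyson equation $-\frac1{m_i(z)}=z-a_i+\sum_{j=1}^d s_{ij}m_j(z)$, $i=1,\dots,d$. For a closed interval $I=[\alpha,\beta]$, $\mathbb C_+(I):=\{z\in\mathbb C_+:\operatorname{Re}z\in I\}$ and $\overline{\mathbb C_+}(I):=\{z:\operatorname{Re}z\in I,\ \operatorname{Im}z\ge0\}$. ''Uniformly bounded on $\mathbb C_+(I)$'' means $\sup_{z\in\mathbb C_+(I)}|m(z)|_2\le\Phi_I$ for some constant $\Phi_I<\infty$; in that case $m$ extends uniquely and continuously to $\overline{\mathbb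 C_+}(I)$, and $m$ denotes this extension there. The relation $f\sim g$ means $cg\le f\le Cg$ with constants $c,C\in(0,\infty)$ that depend only on absolute constants and the fixed model parameters (the data $d,S,\mathbf a,I$ and the bound $\Phi_I$), in particular not on $z$. *)

(* Defs.v *)
From HB Require Import structures.
From mathcomp Require Import all_boot all_order all_algebra.
From mathcomp Require Import complex.
From mathcomp Require Import all_classical all_reals all_analysis.

Set Implicit Arguments.
Unset Strict Implicit.
Unset Printing Implicit Defensive.

Import Order.TTheory GRing.Theory Num.Theory.
Import numFieldNormedType.Exports.

Local Open Scope classical_set_scope.
Local Open Scope complex_scope.
Local Open Scope ring_scope.

Definition l2norm (R : realType) (d : nat) (v : 'cV[R[i]]_d) : R :=
  Num.sqrt (\sum_(i < d) Normc.normc (v i 0) ^+ 2).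

Definition upper (R : realType) : set R[i] := [set z | 0 < complex.Im z].

Definition upper_strip (R : realType) (alpha beta : R) : set R[i] :=
  [set z | complex.Re z \in `[alpha, beta] /\ 0 < complex.Im z].

Definition closed_upper_strip (R : realType) (alpha beta : R) : set R[i] :=
  [set z | complex.Re z \in `[alpha, beta] /\ 0 <= complex.Im z].

Definition nonnegative_mx (R : realType) (d : nat) (S : 'M[R]_d) : Prop :=
  forall i j, 0 <= S i j.

Definition irreducible_mx (R : realType) (d : nat) (S : 'M[R]_d) : Prop :=
  forall i j, exists2 n : nat, (1 <= n)%N & 0 < (S ^+ n) i j.

Definition dyson_equation (R : realType) (d : nat) (S : 'M[R]_d)
    (a : 'cV[R]_d) (z : R[i]) (v : 'cV[R[i]]_d) : Prop :=
  forall i, - (v i 0)^-1 = z - (a i 0)%:C + \sum_(j < d) (S i j)%:C * v j 0.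

(* For entrywise nonnegative [S], [m z] exists and is unique, so that this
   predicate determines [m] on the upper half-plane. *)
Definition dyson_solution (R : realType) (d : nat) (S : 'M[R]_d)
    (a : 'cV[R]_d) (m : R[i] -> 'cV[R[i]]_d) : Prop :=
  forall z, upper z ->
    (forall i, upper (m z i 0)) /\ dyson_equation S a z (m z).

Definition bounded_on_strip (R : realType) (d : nat) (alpha beta Phi : R)
    (m : R[i] -> 'cV[R[i]]_d) : Prop :=
  forall z, upper_strip alpha beta z -> l2norm (m z) <= Phi.

(* The topology of [R[i]] lives on its alias [R[i]^o].  The strip is dense in
   the closed strip, hence [m] has at most one such extension there. *)
Definition continuous_extension (R : realType) (d : nat) (alpha beta : R)
    (m mext : R[i] -> 'cV[R[i]]_d) : Prop :=
  (forall z, upper_strip alpha beta z -> mext z = m z) /\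
  {within (closed_upper_strip alpha beta : set R[i]^o),
    continuous (mext : R[i]^o -> 'cV[R[i]^o]_d)}.

Definition comparable_on (R : realType) (c C : R) (D : set R[i])
    (f g : R[i] -> R) : Prop :=
  forall z, D z -> c * g z <= f z <= C * g z.

(* Main.v *)
Require Import Defs.
From mathcomp Require Import all_boot all_order all_algebra.
From mathcomp Require Import complex.
From mathcomp Require Import all_classical all_reals all_analysis.
From mathcomp Require Import ring lra.

(** On the open strip, [|m_i| <= Phi], [Im m_i >= 0] and
    [m_i (z - a_i + sum_j s_ij m_j) = -1]; these are closed conditions, so they
    hold for the extension on the closed strip, where the rest is algebra.

    Taking norms in the equation gives [1 <= |m_i| (|z| + L)], and reading it as
    [z m_i = -1 - m_i (- a_i + sum_j s_ij m_j)] bounds [(1 + |z|) |m_i|] above.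
    Taking imaginary parts gives [Im m_i = |m_i|^2 (Im z + sum_j s_ij Im m_j)].
    If [Im z <= 1], then [|m_i|] is bounded below and [Im m >= c S (Im m)], which
    iterates to [Im m >= c^n S^n (Im m)], so irreducibility compares all entries.
    If [Im z >= 1], then [Im m_i] is comparable to [|m_i|^2 Im z] because the sum
    is bounded, and the [|m_i|] are comparable to each other. *)

Set Implicit Arguments.
Unset Strict Implicit.
Unset Printing Implicit Defensive.

Import Order.TTheory GRing.Theory Num.Theory.
Import numFieldNormedType.Exports.

Local Open Scope classical_set_scope.
Local Open Scope complex_scope.
Local Open Scope ring_scope.

(** * Modulus and imaginary part in [R[i]] *)

Section ComplexNorm.
Context {R : rcfType}.
Implicit Types x y z : R[i].

Lemma normc_ge0 z : 0 <= Normc.normc z.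
Proof. by case: z => x y; exact: sqrtr_ge0. Qed.

Lemma normc_real (x : R) : Normc.normc x%:C = `|x|.
Proof. by rewrite /= expr0n /= addr0 sqrtr_sqr. Qed.

Lemma le_Im_normc z : `|complex.Im z| <= Normc.normc z.
Proof. by case: z => x y; rewrite /= -sqrtr_sqr ler_wsqrtr// lerDr sqr_ge0. Qed.

Lemma normc_le_ReIm z : Normc.normc z <= `|complex.Re z| + `|complex.Im z|.
Proof.
case: z => x y /=; rewrite -[leRHS]ger0_norm ?addr_ge0// -[leRHS]sqrtr_sqr ler_wsqrtr//.
by rewrite sqrrD !real_normK ?num_real// addrAC lerDl mulrn_wge0// mulr_ge0.
Qed.

Lemma ler_dist_normc x y :
  `|Normc.normc x - Normc.normc y| <= Normc.normc (x - y).
Proof.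
have := le_normcD (x - y) y; have := le_normcD (y - x) x.
by rewrite -(normcN (y - x)) opprB !subrK ler_norml => xy yx; lra.
Qed.

Lemma normc_sum_le (I : Type) (r : seq I) (F : I -> R[i]) :
  Normc.normc (\sum_(i <- r) F i) <= \sum_(i <- r) Normc.normc (F i).
Proof.
elim/big_ind2: _ => [|x a y b xa yb|//]; first by rewrite Normc.normc0.
exact: le_trans (le_normcD _ _) (lerD xa yb).
Qed.

Lemma Im_mul_real (x : R) y : complex.Im (x%:C * y) = x * complex.Im y.
Proof. by case: y => a b /=; rewrite mul0r addr0. Qed.

(** Multiplying [x * y = -1] by the conjugate of [x] gives [|x|^2 y = - conj x]; then compare
    imaginary parts. *)
Lemma Im_opp_inv x y :
  x * y = -1 -> complex.Im x = Normc.normc x ^+ 2 * complex.Im y.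
Proof.
case: x y => [x1 x2] [y1 y2] [re im] /=; rewrite sqr_sqrtr ?addr_ge0 ?sqr_ge0//.
have -> : (x1 ^+ 2 + x2 ^+ 2) * y2 =
    x1 * (x1 * y2 + x2 * y1) - x2 * (x1 * y1 - x2 * y2) by ring.
by rewrite re im; ring.
Qed.

End ComplexNorm.

Lemma le_normc_l2norm (R : realType) (d : nat) (v : 'cV[R[i]]_d) (i : 'I_d) :
  Normc.normc (v i 0) <= l2norm v.
Proof.
rewrite -[leLHS]ger0_norm ?normc_ge0// -sqrtr_sqr ler_wsqrtr//.
by rewrite (bigD1 i)//= lerDl sumr_ge0// => j _; exact: sqr_ge0.
Qed.

(** * Closed conditions, and density of the open strip in the closed one *)

Section ComplexTopology.
Context {R : realType}.
Local Notation C := (R[i]^o).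

Lemma normc_nonexpansive_continuous (f : R[i] -> R) :
  (forall x y, `|f x - f y| <= Normc.normc (x - y)) -> continuous (f : C -> R).
Proof.
move=> fL x; apply/(@cvgrPdist_lt _ _ _ _ (nbhs_filter (x : C))) => e e0.
(* Balls of [C] have radii in [R[i]], so the real [e] has to be embedded. *)
apply/(@nbhs_ballP _ C); exists e%:C; first by rewrite /= ltcR.
by move=> y /=; rewrite /ball /= ltcR; exact: le_lt_trans.
Qed.

Lemma closed_Im_ge0 : closed ([set x | 0 <= complex.Im x] : set C).
Proof.
apply: (@preimage_closed C R (@complex.Im R) [set y | 0 <= y]); last exact: closed_ge.
move=> x _; apply: normc_nonexpansive_continuous => {x} x y.
by rewrite -raddfB; exact: le_Im_normc.
Qed.

Lemma closed_normc_le (M : R) : closed ([set x | Normc.normc x <= M] : set C).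
Proof.
apply: (@preimage_closed C R (@Normc.normc R) [set y | y <= M]); last exact: closed_le.
by move=> x _; apply: normc_nonexpansive_continuous; exact: ler_dist_normc.
Qed.

Lemma closed_upper_strip_closure (alpha beta : R) :
  closed_upper_strip alpha beta `<=` closure (upper_strip alpha beta : set C).
Proof.
move=> [x y] [/= xI y0] B /(@nbhs_ballP _ C) [[e e'] /= e0 eB].
(* Positivity in [R[i]] forces the radius to be real. Moving up by half of it leaves the real part
   alone and makes the imaginary part positive. *)
move: e0; rewrite ltcE /= => /andP[/eqP e'0 e0]; subst e'.
exists (x +i* (y + e / 2)); split; first by split => //=; lra.
apply: eB; rewrite /ball /= ltcE /= eqxx /= subrr opprD addrA subrr sub0r.
by rewrite expr0n /= add0r sqrrN sqrtr_sqr gtr0_norm; lra.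
Qed.

End ComplexTopology.

(* The Dyson equation cleared of denominators: unlike [dyson_equation], where
   [0^-1 = 0], it visibly passes to limits and forces [v i 0 != 0]. *)
Definition dyson_product (R : realType) (d : nat) (S : 'M[R]_d)
    (a : 'cV[R]_d) (z : R[i]) (v : 'cV[R[i]]_d) : Prop :=
  forall i, v i 0 * (z - (a i 0)%:C + \sum_(j < d) (S i j)%:C * v j 0) = -1.

Lemma dyson_solution_product (R : realType) (d : nat) (S : 'M[R]_d)
    (a : 'cV[R]_d) (m : R[i] -> 'cV[R[i]]_d) (z : R[i]) :
  dyson_solution S a m -> upper z -> dyson_product S a z (m z).
Proof.
move=> m_sol zU i; have [mU <-] := m_sol z zU.
rewrite mulrN mulfV//; apply/eqP => m0.
by have := mU i; rewrite /upper /= m0 ltxx.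
Qed.

Lemma continuous_extension_closed_strip (R : realType) (d : nat) (S : 'M[R]_d)
    (a : 'cV[R]_d) (alpha beta Phi : R) (m mext : R[i] -> 'cV[R[i]]_d) :
  dyson_solution S a m -> bounded_on_strip alpha beta Phi m ->
  continuous_extension alpha beta m mext ->
  forall z, closed_upper_strip alpha beta z ->
  [/\ forall i, Normc.normc (mext z i 0) <= Phi,
      forall i, 0 <= complex.Im (mext z i 0) &
      dyson_product S a z (mext z)].
Proof.
move=> m_sol m_bnd [mextE mext_cont] z zD.
(* Limits at [z] are taken along the open strip only, where [mext] is [m]; density makes this filter
   proper. *)
pose F := within (upper_strip alpha beta) (nbhs (z : R[i]^o)).
have FF : ProperFilter F.
  by apply: (@within_nbhs_proper R[i]^o _ z); exact: closed_upper_strip_closure.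
have mext_cvg i : mext w i 0 @[w --> F] --> (mext z i 0 : R[i]^o).
  apply: (@cvg_comp _ _ _ (mext : R[i]^o -> 'cV[R[i]^o]_d) (fun M => M i 0) F
    (nbhs (mext z : 'cV[R[i]^o]_d))); last exact: coord_continuous.
  have cvg_closed : (mext : R[i]^o -> 'cV[R[i]^o]_d) @
      @nbhs_subspace R[i]^o (closed_upper_strip alpha beta) z `=>`
      nbhs (mext z : 'cV[R[i]^o]_d) by exact: mext_cont.
  apply: cvg_trans cvg_closed; rewrite -(@nbhs_subspace_in R[i]^o _ _ zD).
  by apply: cvg_app; apply: within_subset => w [wI /ltW].
have in_F (P : set R[i]) : upper_strip alpha beta `<=` P -> F P.
  by move=> AP; rewrite /F /within/=; apply: nearW.
split=> [i|i|i].
- apply: (@closed_cvg _ R[i]^o F FF _ _ (@closed_normc_le R Phi) _ _ (mext_cvg i)).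
  apply: in_F => w wD; rewrite /= mextE//.
  exact: le_trans (le_normc_l2norm _ _) (m_bnd w wD).
- apply: (@closed_cvg _ R[i]^o F FF _ _ (@closed_Im_ge0 R) _ _ (mext_cvg i)).
  apply: in_F => w wD; rewrite /= mextE//.
  by have [mU _] := m_sol w wD.2; exact: ltW (mU i).
- pose D (w : R[i]) := w - (a i 0)%:C + \sum_(j < d) (S i j)%:C * mext w j 0.
  have D_cvg : D w @[w --> F] --> (D z : R[i]^o).
    apply: (@cvgD R[i] R[i]^o _ F FF (fun w => w - (a i 0)%:C)).
      exact: (@cvgB R[i] R[i]^o _ F FF id _ _ _ (@cvg_within _ _ _ _) (cvg_cst _)).
    apply: (@cvg_big R[i]^o _ +%R) => [x|j _].
      exact: (@add_continuous (TopologicalNmodule.clone R[i]^o _)).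
    exact: (@cvgMr R[i] _ F FF _ _ _ (mext_cvg j)).
  (* The product converges to its value at [z], and is constantly [-1] on the open strip. *)
  apply: (cvg_unique (@norm_hausdorff _ R[i]^o)
    (@cvgM R[i] _ F FF (fun w => mext w i 0) D _ _ (mext_cvg i) D_cvg)).
  apply: cvg_near_cst; apply: in_F => w wD.
  rewrite /D /= (mextE w wD); exact: (dyson_solution_product m_sol wD.2 i).
Qed.

(** * Powers of [S] and irreducibility *)

Section Irreducible.
Context {R : realType} {d : nat}.
Implicit Types (S : 'M[R]_d) (v : 'I_d -> R).

Lemma nonnegative_mxX S n : nonnegative_mx S -> nonnegative_mx (S ^+ n).
Proof.
move=> S0; elim: n => [|n IH] i j; first by rewrite expr0 mxE ler0n.
by rewrite exprS mxE sumr_ge0// => k _; rewrite mulr_ge0.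
Qed.

(** A nonnegative matrix preserves entrywise inequalities, so the induction hypothesis may be
    multiplied by [c S]. *)
Lemma supersolution_mxX S (c : R) v : nonnegative_mx S -> 0 <= c ->
  (forall i, c * \sum_j S i j * v j <= v i) ->
  forall n i, c ^+ n * \sum_j (S ^+ n) i j * v j <= v i.
Proof.
move=> S0 c0 cv; elim=> [|n IH] i.
  rewrite !expr0 mul1r (bigD1 i)//= mxE eqxx mul1r big1 ?addr0// => j ji.
  by rewrite mxE eq_sym (negbTE ji) mul0r.
apply: le_trans (cv i); rewrite exprS -mulrA ler_wpM2l//.
have -> : \sum_j (S ^+ n.+1) i j * v j
    = \sum_j S i j * \sum_k (S ^+ n) j k * v k.
  rewrite exprS; under eq_bigr => j _ do rewrite mxE mulr_suml.
  rewrite exchange_big; apply: eq_bigr => j _.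
  by rewrite mulr_sumr; apply: eq_bigr => k _; rewrite mulrA.
rewrite mulr_sumr ler_sum// => j _.
by rewrite mulrCA ler_wpM2l.
Qed.

Lemma irreducible_supersolution S (c : R) :
  nonnegative_mx S -> irreducible_mx S -> 0 < c ->
  exists2 k : R, 0 < k & forall v, (forall i, 0 <= v i) ->
    (forall i, c * \sum_j S i j * v j <= v i) -> forall i j, k * v j <= v i.
Proof.
move=> S0 Sirr c0.
pose n i j := s2val (cid2 (Sirr i j)).
have Sn0 i j : 0 < (S ^+ n i j) i j by rewrite /n; case: (cid2 _).
(* A minimum of finitely many positive numbers, one for each pair of indices, fixed before [v] is
   given. For the pair [(i, j)] only the [j]-th term of the sum is kept. *)
exists (\big[Num.min/1]_(p : 'I_d * 'I_d)
    (c ^+ n p.1 p.2 * (S ^+ n p.1 p.2) p.1 p.2)).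
  by apply/bigmin_gtP; split=> // p _; rewrite mulr_gt0// exprn_gt0.
move=> v v0 cv i j.
apply: le_trans (supersolution_mxX S0 (ltW c0) cv (n i j) i).
apply: (@le_trans _ _ (c ^+ n i j * ((S ^+ n i j) i j * v j))).
  by rewrite mulrA ler_wpM2r//; exact: (bigmin_le _ (i, j)).
rewrite ler_wpM2l ?exprn_ge0 ?(ltW c0)// (bigD1 j)//= lerDl sumr_ge0// => k _.
by rewrite mulr_ge0// nonnegative_mxX.
Qed.

End Irreducible.

(** * Estimates for the Dyson equation at a single point *)

Section DysonBounds.
Context {R : realType} {d : nat}.
Implicit Types (S : 'M[R]_d) (a : 'cV[R]_d) (M : R) (z : R[i]) (u : 'cV[R[i]]_d).

(** The sum of all entries dominates every row sum, which keeps the constants independent of the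
    row. *)
Definition mx_mass S : R := \sum_i \sum_j S i j.

Definition drift_bound S a M : R := \sum_i `|a i 0| + mx_mass S * M.

Lemma mx_mass_ge0 S : nonnegative_mx S -> 0 <= mx_mass S.
Proof. by move=> S0; rewrite !sumr_ge0// => i _; rewrite sumr_ge0. Qed.

Lemma drift_bound_ge0 S a M : nonnegative_mx S -> 0 <= M -> 0 <= drift_bound S a M.
Proof. by move=> S0 M0; rewrite addr_ge0 ?sumr_ge0// mulr_ge0// mx_mass_ge0. Qed.

Lemma mx_mass_le S M (v : 'I_d -> R) i : nonnegative_mx S -> 0 <= M ->
  (forall j, v j <= M) -> \sum_j S i j * v j <= mx_mass S * M.
Proof.
move=> S0 M0 vM; apply: (@le_trans _ _ (\sum_j S i j * M)).
  by rewrite ler_sum// => j _; rewrite ler_wpM2l.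
rewrite -mulr_suml ler_wpM2r// /mx_mass [leRHS](bigD1 i)//= lerDl sumr_ge0// => j _.
by rewrite sumr_ge0.
Qed.

Lemma drift_le S a M u i : nonnegative_mx S -> 0 <= M ->
  (forall j, Normc.normc (u j 0) <= M) ->
  Normc.normc (- (a i 0)%:C + \sum_(j < d) (S i j)%:C * u j 0) <= drift_bound S a M.
Proof.
move=> S0 M0 uM; apply: le_trans (le_normcD _ _) (lerD _ _).
  by rewrite normcN normc_real (bigD1 i)//= lerDl sumr_ge0.
apply: le_trans (normc_sum_le _ _) _.
under eq_bigr => j _ do rewrite Normc.normcM normc_real ger0_norm//.
exact: (@mx_mass_le _ _ (fun j => Normc.normc (u j 0))).
Qed.

Lemma dyson_normc_lower S a M z u i : nonnegative_mx S -> 0 <= M ->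
  (forall j, Normc.normc (u j 0) <= M) -> dyson_product S a z u ->
  1 <= (1 + drift_bound S a M) * (1 + Normc.normc z) * Normc.normc (u i 0).
Proof.
move=> S0 M0 uM u_dyson.
have := congr1 (@Normc.normc R) (u_dyson i).
rewrite Normc.normcM normcN Normc.normc1 => E; rewrite -[leLHS]E {E}.
rewrite -addrA mulrC ler_wpM2r ?normc_ge0//; apply: le_trans (le_normcD _ _) _.
have := drift_le a i S0 M0 uM; have := normc_ge0 z.
move=> z0 fL; have L0 := drift_bound_ge0 a S0 M0.
by have := mulr_ge0 L0 z0; lra.
Qed.

(** The summand [M] covers the 1 in [1 + |z|]; the equation bounds [|z| |u_i|] by the rest. *)
Lemma dyson_normc_upper S a M z u i : nonnegative_mx S -> 0 <= M ->
  (forall j, Normc.normc (u j 0) <= M) -> dyson_product S a z u ->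
  (1 + Normc.normc z) * Normc.normc (u i 0) <= M + 1 + M * drift_bound S a M.
Proof.
move=> S0 M0 uM u_dyson.
pose f := - (a i 0)%:C + \sum_(j < d) (S i j)%:C * u j 0.
have uz : u i 0 * z = - 1 - u i 0 * f by rewrite -(u_dyson i) /f; ring.
rewrite mulrDl mul1r -Normc.normcM (mulrC z) uz -addrA lerD//.
apply: le_trans (le_normcD _ _) _.
rewrite !normcN Normc.normc1 Normc.normcM lerD2l.
by rewrite ler_pM ?normc_ge0// drift_le.
Qed.

Lemma dyson_Im S a z u i : dyson_product S a z u ->
  complex.Im (u i 0) = Normc.normc (u i 0) ^+ 2 *
    (complex.Im z + \sum_j S i j * complex.Im (u j 0)).
Proof.
move=> u_dyson; rewrite (Im_opp_inv (u_dyson i)) !raddfD/= raddf_sum oppr0 addr0.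
by congr (_ * (_ + _)); apply: eq_bigr => j _; exact: Im_mul_real.
Qed.

(** Only [Re z] is bounded, so [|u_i|] has no uniform lower bound; this is why [Im z <= 1] and
    [Im z > 1] are treated separately. *)
Lemma dyson_Im_comparable S a M (B : R) : nonnegative_mx S -> irreducible_mx S ->
  0 <= M -> 0 <= B ->
  exists2 k : R, 0 < k & forall z u, `|complex.Re z| <= B -> 0 <= complex.Im z ->
    (forall i, Normc.normc (u i 0) <= M) -> (forall i, 0 <= complex.Im (u i 0)) ->
    dyson_product S a z u ->
    forall i j, k * complex.Im (u j 0) <= complex.Im (u i 0).
Proof.
move=> S0 Sirr M0 B0.
have L0 := drift_bound_ge0 a S0 M0; have s0 := mx_mass_ge0 S0.
have sM0 := mulr_ge0 s0 M0; have ML0 := mulr_ge0 M0 L0.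
pose K := 1 + drift_bound S a M; pose C := M + 1 + M * drift_bound S a M.
have K0 : 0 < K by rewrite /K; lra.
have C0 : 0 < C by rewrite /C; lra.
(* For [Im z > 1], [Im z] plus the sum is at most [A * Im z]. *)
pose A := 1 + mx_mass S * M; have A0 : 0 < A by rewrite /A; lra.
have KB0 : 0 < K * (2 + B) by rewrite mulr_gt0//; lra.
(* If [Im z <= 1] then [1 + |z| <= 2 + B], so this is a lower bound for [|u_l|^2]. *)
have c0 : 0 < (K * (2 + B)) ^- 2 by rewrite invr_gt0 exprn_gt0.
have [k k0 kP] := irreducible_supersolution S0 Sirr c0.
have KC0 : 0 < K * C by rewrite mulr_gt0.
exists (Num.min k (((K * C) ^+ 2 * A)^-1)).
  by rewrite lt_min k0 invr_gt0 mulr_gt0// exprn_gt0.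
move=> z u zB z0 uM u0 u_dyson i j.
have lo l := dyson_normc_lower l S0 M0 uM u_dyson.
have up l := dyson_normc_upper l S0 M0 uM u_dyson.
have nz0 := normc_ge0 z.
have ImE l := dyson_Im l u_dyson.
have sum0 l : 0 <= \sum_j0 S l j0 * complex.Im (u j0 0).
  by rewrite sumr_ge0// => j0 _; rewrite mulr_ge0.
have [z1|z1] := leP (complex.Im z) 1.
- apply: le_trans (kP (fun l => complex.Im (u l 0)) u0 _ i j).
    by rewrite ler_wpM2r// ge_min lexx.
  move=> l; rewrite [leRHS]ImE ler_pM// ?(ltW c0)//; last by rewrite lerDr.
  rewrite -exprVn lerXn2r ?nnegrE ?normc_ge0 ?invr_ge0 ?(ltW KB0)//.
  rewrite -div1r ler_pdivrMr// mulrC; apply: le_trans (lo l) _.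
  rewrite ler_wpM2r ?normc_ge0// ler_wpM2l ?(ltW K0)//.
  by have := normc_le_ReIm z; rewrite (ger0_norm z0); lra.
(* The upper bound for [u_j] and the lower bound for [u_i] carry the same factor [1 + |z|], which
   cancels. *)
- have cmp : Normc.normc (u j 0) <= K * C * Normc.normc (u i 0).
    have t0 : 0 < 1 + Normc.normc z by lra.
    rewrite -(ler_pM2l t0); apply: le_trans (up j) _.
    have := ler_wpM2l (ltW C0) (lo i); rewrite mulr1 => /le_trans; apply.
    by rewrite le_eqVlt; apply/orP; left; apply/eqP; rewrite /K; ring.
  have sumM : \sum_j0 S j j0 * complex.Im (u j0 0) <= mx_mass S * M.
    apply: (@mx_mass_le _ _ (fun l => complex.Im (u l 0))) => // l.
    exact: le_trans (ler_norm _) (le_trans (le_Im_normc _) (uM l)).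
  apply: (@le_trans _ _ (((K * C) ^+ 2 * A)^-1 * complex.Im (u j 0))).
    by rewrite ler_wpM2r// ge_min lexx orbT.
  rewrite mulrC ler_pdivrMr ?mulr_gt0 ?exprn_gt0//.
  apply: (@le_trans _ _ ((K * C * Normc.normc (u i 0)) ^+ 2 * (A * complex.Im z))).
    rewrite ImE ler_pM ?sqr_ge0 ?addr_ge0//.
      by rewrite lerXn2r ?nnegrE ?normc_ge0// mulr_ge0 ?normc_ge0// ltW.
    have := ler_wpM2l sM0 (ltW z1); rewrite /A; lra.
  rewrite [in leRHS]ImE exprMn.
  have -> : (K * C) ^+ 2 * Normc.normc (u i 0) ^+ 2 * (A * complex.Im z) =
     Normc.normc (u i 0) ^+ 2 * complex.Im z * ((K * C) ^+ 2 * A) by ring.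
  rewrite ler_wpM2r ?mulr_ge0 ?sqr_ge0 ?(ltW A0) ?(ltW K0) ?(ltW C0)//.
  by rewrite ler_wpM2l ?sqr_ge0// lerDl.
Qed.

End DysonBounds.

Theorem theorem2p5 (R : realType) (d : nat) (d_ge1 : (1 <= d)%N)
    (S : 'M[R]_d) (a : 'cV[R]_d) (alpha beta Phi : R)
    (alpha_le_beta : alpha <= beta)
    (S_ge0 : nonnegative_mx S) (S_irr : irreducible_mx S) :
  exists c C : R, [/\ 0 < c, 0 < C &
    forall m mext : R[i] -> 'cV[R[i]]_d,
      dyson_solution S a m ->
      bounded_on_strip alpha beta Phi m ->
      continuous_extension alpha beta m mext ->
      (forall i : 'I_d,
         comparable_on c C (closed_upper_strip alpha beta)
           (fun z => Normc.normc (mext z i 0)) (fun z => (1 + Normc.normc z)^-1)) /\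
      (forall i j : 'I_d, (i < j)%N ->
         comparable_on c C (closed_upper_strip alpha beta)
           (fun z => complex.Im (mext z i 0))
           (fun z => complex.Im (mext z j 0)))].
Proof.
(* The sign of [Phi] is not given, and the estimates want a nonnegative bound; [B] bounds [|Re z|]
   on the strip. *)
pose M := `|Phi|; pose B := `|alpha| + `|beta|.
have M0 : 0 <= M by rewrite /M.
have B0 : 0 <= B by rewrite /B addr_ge0.
have [k k0 kP] := dyson_Im_comparable a S_ge0 S_irr M0 B0.
have L0 := drift_bound_ge0 a S_ge0 M0.
pose K := 1 + drift_bound S a M; pose C := M + 1 + M * drift_bound S a M.
have K0 : 0 < K by rewrite /K; lra.
have C0 : 0 < C by have := mulr_ge0 M0 L0; rewrite /C; lra.
(* One pair of constants for both claims: [K^-1] and [C] serve the moduli, [k] and [k^-1] the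
   imaginary parts. *)
exists (Num.min K^-1 k), (Num.max C k^-1); split.
- by rewrite lt_min k0 invr_gt0 K0.
- by rewrite lt_max C0.
move=> m mext m_sol m_bnd m_ext.
have props z (zD : closed_upper_strip alpha beta z) :
    (forall i, Normc.normc (mext z i 0) <= M) /\
    (forall i, 0 <= complex.Im (mext z i 0)) /\ dyson_product S a z (mext z).
  have [u1 u2 u3] := continuous_extension_closed_strip m_sol m_bnd m_ext zD.
  by split=> [i|//]; exact: le_trans (u1 i) (ler_norm _).
split=> [i z zD|i j _ z zD].
- have [uM [u0 u_dyson]] := props z zD.
  have t0 : 0 < 1 + Normc.normc z by have := normc_ge0 z; lra.
  apply/andP; split.
  + apply: (@le_trans _ _ (K^-1 * (1 + Normc.normc z)^-1)).
      by rewrite ler_wpM2r ?invr_ge0 ?(ltW t0)// ge_min lexx.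
    rewrite -invfM -div1r ler_pdivrMr ?mulr_gt0// mulrC.
    exact: dyson_normc_lower.
  + rewrite ler_pdivlMr// mulrC le_max; apply/orP; left.
    exact: dyson_normc_upper.
- have [uM [u0 u_dyson]] := props z zD.
  have zB : `|complex.Re z| <= B.
    case: zD => + _; rewrite in_itv /= => /andP[az zb]; rewrite ler_norml /B.
    have := ler_norm (- alpha); rewrite normrN; have := ler_norm beta.
    have := normr_ge0 alpha; have := normr_ge0 beta => *; apply/andP; split; lra.
  have cmp := kP z (mext z) zB zD.2 uM u0 u_dyson.
  apply/andP; split.
  + by apply: le_trans (cmp i j); rewrite ler_wpM2r// ge_min lexx orbT.
  (* The upper bound is [cmp] with the two indices exchanged. *)
  + apply: (@le_trans _ _ (k^-1 * complex.Im (mext z j 0))).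
      by rewrite -ler_pdivrMl ?invr_gt0// invrK.
    by rewrite ler_wpM2r// le_max lexx orbT.
Qed.
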